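(* Let $q\in\mathbb{K}\setminus\{0\}$ with $q\neq-1,1$. For the Hom-Leibniz algebras $(\mathcal{W}^q,\{\cdot,\cdot\}^i,\alpha)$, $i\in\{1,\dots,5\}$, given in the context: (i) $(\mathcal{W}^q,\{\cdot,\cdot\}^1,\alpha)$ is multiplicative if and only if $q^2=-1$ or $\nu_1=\nu_2=\nu_3=\nu_4=\gamma=0$; (ii) $(\mathcal{W}^q,\{\cdot,\cdot\}^2,\alpha)$ is multiplicative if and only if $q^2=-1$; (iii) $(\mathcal{W}^q,\{\cdot,\cdot\}^3,\alpha)$ is multiplicative if and only if $q^2=-1$; (iv) $(\mathcal{W}^q,\{\cdot,\cdot\}^4,\alpha)$ is multiplicative if and only if $q^2=-1$; (v) $(\mathcal{W}^q,\{\cdot,\cdot\}^5,\alpha)$ is multiplicative if and only if $q^2=-1$.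
   Context: $\mathbb{K}$ is a field of characteristic zero. For $q\in\mathbb{K}\setminus\{0,1,-1\}$ and $n\in\mathbb{Z}$ put $[n]=\frac{q^n-q^{-n}}{q-q^{-1}}$. $\mathcal{W}^q$ is the $\mathbb{K}$-vector space with basis $\{L_n,W_n\mid n\in\mathbb{Z}\}$ and $\alpha$ is the linear map $\alpha(L_n)=(q^n+q^{-n})L_n$, $\alpha(W_n)=(q^n+q^{-n})W_n$. A Hom-algebra $(A,\{\cdot,\cdot\},\alpha)$ is multiplicative if $\alpha(\{x,y\})=\{\alpha(x),\alpha(y)\}$ for all $x,y\in A$. The Hom-Leibniz algebras (induced by homogeneous averaging operators of degree $d$ with $q^d=1$ on the $q$-deformed $W(2,2)$ Hom-algebra) have the following bilinear products, for all $m,n\in\mathbb{Z}$, writing $\delta=\delta_{q^{2m},1}$ (equal to $1$ if $q^{2m}=1$ and $0$ otherwise), with $\nu_1,\nu_2,\nu_3,\nu_4,\gamma,\theta\in\mathbb{K}$, $\beta\in\mathbb{K}\setminus\{0\}$: (1) $\{L_m,L_n\}^1=\nu_1\delta[m-n]L_{m+n}+(\nu_3\delta+\gamma)[m-n]W_{m+n}$, $\{L_m,W_n\}^1=\nu_1\delta[m-n]W_{m+n}$, $\{W_m,L_n\}^1=\nu_2\delta[m-n]L_{m+n}+\nu_4\delta[m-n]W_{m+n}$, $\{W_m,W_n\}^1=\nu_2\delta[m-n]W_{m+n}$; (2) $\{L_m,L_n\}^2=(\nu_1\delta+\beta)[m-n]L_{m+n}+(\nu_3\delta+\gamma)[m-n]W_{m+n}$,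 $\{L_m,W_n\}^2=(\nu_1\delta+\beta)[m-n]W_{m+n}$, $\{W_m,L_n\}^2=\nu_2\delta[m-n]L_{m+n}+\nu_4\delta[m-n]W_{m+n}$, $\{W_m,W_n\}^2=\nu_2\delta[m-n]W_{m+n}$; (3) $\{L_m,L_n\}^3=(\nu_1\delta+\beta)[m-n]L_{m+n}+\nu_3\delta[m-n]W_{m+n}$, $\{L_m,W_n\}^3=(\nu_1\delta+\beta)[m-n]W_{m+n}$, $\{W_m,L_n\}^3=\nu_2\delta[m-n]L_{m+n}+(\nu_4\delta+\beta)[m-n]W_{m+n}$, $\{W_m,W_n\}^3=\nu_2\delta[m-n]W_{m+n}$; (4) $\{L_m,L_n\}^4=(\nu_1\delta+\gamma)[m-n]L_{m+n}+\nu_3\delta[m-n]W_{m+n}$, $\{L_m,W_n\}^4=(\nu_1\delta+\gamma)[m-n]W_{m+n}$, $\{W_m,L_n\}^4=\nu_2\delta[m-n]L_{m+n}+(\nu_4\delta+\beta)[m-n]W_{m+n}$, $\{W_m,W_n\}^4=\nu_2\delta[m-n]W_{m+n}$; (5) $\{L_m,L_n\}^5=(\nu_1\delta+\gamma)[m-n]L_{m+n}+\big(\nu_3\delta+\frac{\gamma\theta-\gamma^2}{\beta}\big)[m-n]W_{m+n}$, $\{L_m,W_n\}^5=(\nu_1\delta+\gamma)[m-n]W_{m+n}$, $\{W_m,L_n\}^5=(\nu_2\delta+\beta)[m-n]L_{m+n}+(\nu_4\delta+\theta-\gamma)[m-n]W_{m+n}$, $\{W_m,W_n\}^5=(\nu_2\delta+\beta)[m-n]W_{m+n}$.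 *)

(* Defs.v *)
From HB Require Import structures.
From mathcomp Require Import all_boot all_order all_algebra finmap monalg.

Set Implicit Arguments.
Unset Strict Implicit.
Unset Printing Implicit Defensive.

Import GRing.Theory.
Local Open Scope ring_scope.

Record homAlgebra (K : fieldType) := HomAlgebra {
  hom_carrier :> lmodType K;
  hom_bracket : {bilinear hom_carrier -> hom_carrier -> hom_carrier};
  hom_twist : {linear hom_carrier -> hom_carrier}
}.

Definition hom_multiplicative (K : fieldType) (A : homAlgebra K) : Prop :=
  forall x y : A,
    hom_twist A (hom_bracket A x y)
      = hom_bracket A (hom_twist A x) (hom_twist A y).

Section LinearExtension.
Context (K : fieldType) (T : choiceType) (V : lmodType K).

Definition lin_ext (f : T -> V) (x : {malg K[T]}) : V :=
  \sum_(t <- msupp x) x@_t *: f t.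

Lemma lin_extE (f : T -> V) (d : {fset T}) (x : {malg K[T]}) :
  (msupp x `<=` d)%fset -> lin_ext f x = \sum_(t <- d) x@_t *: f t.
Proof.
move=> le_xd; rewrite /lin_ext; apply: big_fset_incl => // t _.
by move/mcoeff_outdom => ->; rewrite scale0r.
Qed.

Lemma lin_extU (f : T -> V) (t : T) : lin_ext f << t >> = f t.
Proof. by rewrite (lin_extE f msuppU_le) big_seq_fset1 mcoeffUU scale1r. Qed.

Lemma lin_ext_is_linear (f : T -> V) : linear (lin_ext f).
Proof.
move=> a x y.
pose d := (msupp (a *: x + y) `|` (msupp x `|` msupp y))%fset.
have le_xyd : (msupp (a *: x + y) `<=` d)%fset by exact: fsubsetUl.
have le_xd : (msupp x `<=` d)%fset.
  exact: fsubset_trans (fsubsetUl _ _) (fsubsetUr _ _).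
have le_yd : (msupp y `<=` d)%fset.
  exact: fsubset_trans (fsubsetUr _ _) (fsubsetUr _ _).
rewrite (lin_extE f le_xyd) (lin_extE f le_xd) (lin_extE f le_yd).
rewrite scaler_sumr -big_split /=; apply: eq_bigr => t _.
by rewrite mcoeffD mcoeffZ scalerDl scalerA.
Qed.

HB.instance Definition _ (f : T -> V) :=
  GRing.isLinear.Build K {malg K[T]} V *:%R (lin_ext f) (lin_ext_is_linear f).

Definition bilin_ext (f : T -> T -> V) (x y : {malg K[T]}) : V :=
  lin_ext (fun s => lin_ext (f s) y) x.

Lemma bilin_extU (f : T -> T -> V) (s t : T) :
  bilin_ext f << s >> << t >> = f s t.
Proof. by rewrite /bilin_ext !lin_extU. Qed.

Lemma bilin_ext_is_bilinear (f : T -> T -> V) :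
  bilinear_for *:%R *:%R (bilin_ext f).
Proof.
split=> [y a x x' | x a y y']; first exact: lin_ext_is_linear.
have xE g : lin_ext g x = \sum_(s <- msupp x) x@_s *: g s by [].
rewrite /bilin_ext !xE /= scaler_sumr -big_split.
apply: eq_bigr => s _ /=.
by rewrite linearP scalerDr !scalerA mulrC.
Qed.

HB.instance Definition _ (f : T -> T -> V) :=
  bilinear_isBilinear.Build K {malg K[T]} {malg K[T]} V *:%R *:%R
    (bilin_ext f) (bilin_ext_is_bilinear f).

End LinearExtension.

(* [inl n] indexes the basis vector L_n and [inr n] the basis vector W_n. *)
Definition genW : choiceType := (int + int)%type.

Definition Wq (K : fieldType) : lmodType K := {malg K[genW]}.

Section Products.
Context (K : fieldType) (q : K).

Definition L (n : int) : Wq K := << inl n : genW >>.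
Definition W (n : int) : Wq K := << inr n : genW >>.

Definition qnum (n : int) : K := (q ^ n - q ^ (- n)) / (q - q^-1).
Local Notation "[ n ]q" := (qnum n) (at level 0, n at level 99).

Definition delta (m : int) : K := (q ^ (2 * m) == 1)%:R.

Definition alpha_basis (x : genW) : Wq K :=
  match x with
  | inl n => (q ^ n + q ^ (- n)) *: L n
  | inr n => (q ^ n + q ^ (- n)) *: W n
  end.

Definition WqHom (f : genW -> genW -> Wq K) : homAlgebra K :=
  @HomAlgebra K (Wq K) (bilin_ext f) (lin_ext alpha_basis).

Definition prod1 (nu1 nu2 nu3 nu4 gamma : K) (x y : genW) : Wq K :=
  match x, y with
  | inl m, inl n => (nu1 * delta m * [m - n]q) *: L (m + n)
                    + ((nu3 * delta m + gamma) * [m - n]q) *: W (m + n)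
  | inl m, inr n => (nu1 * delta m * [m - n]q) *: W (m + n)
  | inr m, inl n => (nu2 * delta m * [m - n]q) *: L (m + n)
                    + (nu4 * delta m * [m - n]q) *: W (m + n)
  | inr m, inr n => (nu2 * delta m * [m - n]q) *: W (m + n)
  end.

Definition prod2 (nu1 nu2 nu3 nu4 beta gamma : K) (x y : genW) : Wq K :=
  match x, y with
  | inl m, inl n => ((nu1 * delta m + beta) * [m - n]q) *: L (m + n)
                    + ((nu3 * delta m + gamma) * [m - n]q) *: W (m + n)
  | inl m, inr n => ((nu1 * delta m + beta) * [m - n]q) *: W (m + n)
  | inr m, inl n => (nu2 * delta m * [m - n]q) *: L (m + n)
                    + (nu4 * delta m * [m - n]q) *: W (m + n)
  | inr m, inr n => (nu2 * delta m * [m - n]q) *: W (m + n)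
  end.

Definition prod3 (nu1 nu2 nu3 nu4 beta : K) (x y : genW) : Wq K :=
  match x, y with
  | inl m, inl n => ((nu1 * delta m + beta) * [m - n]q) *: L (m + n)
                    + (nu3 * delta m * [m - n]q) *: W (m + n)
  | inl m, inr n => ((nu1 * delta m + beta) * [m - n]q) *: W (m + n)
  | inr m, inl n => (nu2 * delta m * [m - n]q) *: L (m + n)
                    + ((nu4 * delta m + beta) * [m - n]q) *: W (m + n)
  | inr m, inr n => (nu2 * delta m * [m - n]q) *: W (m + n)
  end.

Definition prod4 (nu1 nu2 nu3 nu4 beta gamma : K) (x y : genW) : Wq K :=
  match x, y with
  | inl m, inl n => ((nu1 * delta m + gamma) * [m - n]q) *: L (m + n)
                    + (nu3 * delta m * [m - n]q) *: W (m + n)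
  | inl m, inr n => ((nu1 * delta m + gamma) * [m - n]q) *: W (m + n)
  | inr m, inl n => (nu2 * delta m * [m - n]q) *: L (m + n)
                    + ((nu4 * delta m + beta) * [m - n]q) *: W (m + n)
  | inr m, inr n => (nu2 * delta m * [m - n]q) *: W (m + n)
  end.

Definition prod5 (nu1 nu2 nu3 nu4 beta gamma theta : K) (x y : genW) : Wq K :=
  match x, y with
  | inl m, inl n =>
      ((nu1 * delta m + gamma) * [m - n]q) *: L (m + n)
      + ((nu3 * delta m + (gamma * theta - gamma ^+ 2) / beta) * [m - n]q)
          *: W (m + n)
  | inl m, inr n => ((nu1 * delta m + gamma) * [m - n]q) *: W (m + n)
  | inr m, inl n =>
      ((nu2 * delta m + beta) * [m - n]q) *: L (m + n)
      + ((nu4 * delta m + theta - gamma) * [m - n]q) *: W (m + n)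
  | inr m, inr n => ((nu2 * delta m + beta) * [m - n]q) *: W (m + n)
  end.

End Products.

(* Main.v *)
Require Import Defs.
From HB Require Import structures.
From mathcomp Require Import all_boot all_order all_algebra.
From mathcomp Require Import finmap monalg ring.
Local Open Scope ring_scope.

Import GRing.Theory.

(** The twist is diagonal: it scales a basis vector of degree [n] by
    [w n = q^n + q^-n], and these weights satisfy
    [w m * w n = w (m + n) + w (m - n)].  Every one of the five brackets adds
    degrees, so on basis vectors [x], [y] of degrees [m], [n] the defect
    [alpha {x, y} - {alpha x, alpha y}] is [- w (m - n) {x, y}]
    ([multiplicative_gradedP]).  Hence multiplicativity says exactly that
    [w (m - n)] kills [{x, y}] for all basis vectors.

    All five brackets are also of one shape: the four structure coefficients
    are functions of the left degree [m] alone, multiplied by the q-number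
    [m - n].  If [q^2 = -1], then [w k] times the q-number of [k] vanishes for
    every [k], since it is a multiple of [q^(2k) - q^(-2k)]; so each bracket is
    multiplicative.  If [q^2 != -1], the choice [n = m - 1] makes both factors
    nonzero, so multiplicativity forces all the coefficient functions to vanish
    ([multiplicative_coefP]).  Finally, a coefficient function
    [nu * delta m + beta] vanishes identically only if [nu = beta = 0], because
    [delta 0 = 1] and [delta 1 = 0] ([delta_affine_eq0]).  When [beta] is
    nonzero only [q^2 = -1] is left. *)

(** * Linear maps on a space with a basis *)

Section LinearExtensionTheory.
Context {K : fieldType} {T : choiceType} {V : lmodType K}.

Lemma malg_basis_sum (x : {malg K[T]}) :
  x = \sum_(t <- msupp x) x@_t *: << t >>.
Proof.
rewrite {1}(monalgE x); apply: eq_bigr => t _.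
by apply/malgP => u; rewrite mcoeffZ !mcoeffU mulrnAr mulr1.
Qed.

Lemma eq_bilinear_basis (g h : {malg K[T]} -> {malg K[T]} -> V) :
  bilinear_for *:%R *:%R g -> bilinear_for *:%R *:%R h ->
  (forall s t, g << s >> << t >> = h << s >> << t >>) ->
  forall x y, g x y = h x y.
Proof.
move=> gbil hbil gh x y.
pose gB := bilinear_isBilinear.Build K _ _ V *:%R *:%R g gbil.
pose hB := bilinear_isBilinear.Build K _ _ V *:%R *:%R h hbil.
pose g' : {bilinear {malg K[T]} -> {malg K[T]} -> V} := HB.pack g gB.
pose h' : {bilinear {malg K[T]} -> {malg K[T]} -> V} := HB.pack h hB.
rewrite -[LHS]/(g' x y) -[RHS]/(h' x y).
rewrite (malg_basis_sum x) (malg_basis_sum y).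
rewrite !linear_sumlz; apply: eq_bigr => s _.
rewrite !linear_sumr; apply: eq_bigr => t _.
by rewrite !linearZl_LR !linearZr_LR /= gh.
Qed.

End LinearExtensionTheory.

(** * Weights of the twist *)

Section Weights.
Context {K : fieldType} (q : K).
Hypothesis q_neq0 : q != 0.

Definition weight (n : int) : K := q ^ n + q ^ (- n).

Lemma weightM (m n : int) :
  weight m * weight n = weight (m + n) + weight (m - n).
Proof.
rewrite /weight !opprD !opprK !expfzDr //.
by ring.
Qed.

Lemma weight1_eq0 : (weight 1 == 0) = (q ^+ 2 == -1).
Proof.
rewrite -(inj_eq (mulfI q_neq0)) mulr0 mulrDr expr1z exprN1 divff //.
by rewrite -expr2 addr_eq0.
Qed.

(** The product is [(q^(2k) - q^(-2k)) / (q - q^-1)], and both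
    powers equal [(-1)^k] when [q^2 = -1]. *)
Lemma qnum_weight_eq0 (k : int) : q ^+ 2 = -1 -> qnum q k * weight k = 0.
Proof.
move=> q2; have qk2 : (q ^ (- k)) ^+ 2 = (q ^ k) ^+ 2.
  rewrite !exprnP !exprz_exp ![_ * 2%:Z]mulrC -!exprz_exp -exprz_inv.
  by rewrite -exprnP q2 invrN invr1.
by rewrite /qnum /weight mulrAC -subr_sqr qk2 subrr mul0r.
Qed.

Hypotheses (q_neq1 : q != 1) (q_neqN1 : q != -1).

Lemma sqr_neq1 : q ^+ 2 != 1.
Proof. by rewrite sqrf_eq1 negb_or q_neq1. Qed.

Lemma qnum1 : qnum q 1 = 1.
Proof.
rewrite /qnum expr1z exprN1 divff // subr_eq0.
by apply: contra sqr_neq1 => /eqP qE; rewrite expr2 {2}qE divff.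
Qed.

Lemma delta0 : delta q 0 = 1.
Proof. by rewrite /delta mulr0 expr0z eqxx. Qed.

Lemma delta1 : delta q 1 = 0.
Proof. by rewrite /delta mulr1 -exprnP (negbTE sqr_neq1). Qed.

Lemma delta_scale_eq0 (nu : K) : (forall m, nu * delta q m = 0) -> nu = 0.
Proof. by move/(_ 0); rewrite delta0 mulr1. Qed.

Lemma delta_affine_eq0 (nu beta : K) :
  (forall m, nu * delta q m + beta = 0) -> nu = 0 /\ beta = 0.
Proof.
move=> z; have := z 1; rewrite delta1 mulr0 add0r => b0.
by split=> //; have := z 0; rewrite delta0 mulr1 b0 addr0.
Qed.

End Weights.

(** * Multiplicativity of graded brackets *)

Section GradedBrackets.
Context {K : fieldType} (q : K).
Hypothesis q_neq0 : q != 0.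

Definition deg (x : genW) : int := match x with inl n => n | inr n => n end.

Definition twist : Wq K -> Wq K := lin_ext (alpha_basis q).

HB.instance Definition _ := GRing.Linear.copy twist (lin_ext (alpha_basis q)).

Lemma alpha_basisE (x : genW) : alpha_basis q x = weight q (deg x) *: << x >>.
Proof. by case: x. Qed.

Lemma twistL (n : int) : twist (L K n) = weight q n *: L K n.
Proof. exact: lin_extU. Qed.

Lemma twistW (n : int) : twist (W K n) = weight q n *: W K n.
Proof. exact: lin_extU. Qed.

(** For a degree-additive bracket the twist multiplies [{x, y}] by [w (m + n)]
    and its arguments by [w m * w n]; by [weightM] the difference of these two
    scalars is [- w (m - n)]. *)
Lemma multiplicative_gradedP (f : genW -> genW -> Wq K) :
  (forall x y, twist (f x y) = weight q (deg x + deg y) *: f x y) ->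
  hom_multiplicative (WqHom q f) <->
  (forall x y, weight q (deg x - deg y) *: f x y = 0).
Proof.
move=> fgr.
have defect x y :
    twist (f x y) - bilin_ext f (alpha_basis q x) (alpha_basis q y) =
    - (weight q (deg x - deg y) *: f x y).
  rewrite !alpha_basisE linearZl_LR linearZr_LR /= bilin_extU fgr scalerA.
  by rewrite weightM // -scalerBl -scaleNr; congr (_ *: _); ring.
split=> [mul x y | vanish].
  apply: oppr_inj; rewrite -defect oppr0.
  have := mul << x >> << y >>.
  by rewrite /= bilin_extU !lin_extU => <-; rewrite subrr.
apply: (@eq_bilinear_basis _ _ _ (fun u v => twist (bilin_ext f u v))
  (fun u v => bilin_ext f (twist u) (twist v))) => [||s t]; last first.
  rewrite /twist !lin_extU bilin_extU; apply/eqP; rewrite -subr_eq0.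
  by rewrite defect vanish oppr0.
- by split=> [v a u u' | u a v v']; rewrite linearP (linearPl, linearPr).
- by split=> [v a u u' | u a v v']; rewrite (linearPl, linearPr) linearP.
Qed.

(** The common shape of the five brackets.  In each of them [{x, W_n}] is
    obtained from [{x, L_n}] by sending [L] to [W] and [W] to [0], which is why
    [A] serves in both cases. *)
Definition left_prod (A B : genW -> K) (x y : genW) : Wq K :=
  match y with
  | inl n => (A x * qnum q (deg x - n)) *: L K (deg x + n)
             + (B x * qnum q (deg x - n)) *: W K (deg x + n)
  | inr n => (A x * qnum q (deg x - n)) *: W K (deg x + n)
  end.

Hypotheses (q_neq1 : q != 1) (q_neqN1 : q != -1).

Lemma LW_free (a b : K) (n : int) :
  a *: L K n + b *: W K n = 0 -> a = 0 /\ b = 0.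
Proof.
move/malgP => z; have := (z (inl n), z (inr n)).
rewrite !mcoeffD !mcoeffZ !mcoeffU !mcoeff0 !eqxx /=.
by rewrite !mulr1 !mulr0 addr0 add0r => -[].
Qed.

(** Since [A] and [B] ignore the right argument, a single right degree at which
    the weight and the q-number are both nonzero already detects them. *)
Lemma multiplicative_left_prodP (A B : genW -> K) (f : genW -> genW -> Wq K) :
  f =2 left_prod A B ->
  hom_multiplicative (WqHom q f) <->
  q ^+ 2 = -1 \/ forall x, A x = 0 /\ B x = 0.
Proof.
move=> fE; rewrite multiplicative_gradedP; last first.
  move=> x [] n; rewrite fE /=.
    rewrite linearD !linearZ /= twistL twistW.
    by rewrite scalerDr !scalerA ![weight _ _ * _]mulrC.
  by rewrite linearZ /= twistW !scalerA mulrC.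
split=> [vanish | vanish x y].
  have [q2 | q2] := eqVneq (q ^+ 2) (-1); [by left | right => x].
  (* with n = deg x - 1 the q-number is 1 and the weight is q + q^-1 *)
  have := vanish x (inl (deg x - 1)).
  rewrite fE /= opprB [deg x + (1 - _)]addrC subrK qnum1 // !mulr1.
  move/eqP; rewrite scaler_eq0 weight1_eq0 // (negbTE q2) /=.
  by move/eqP/LW_free.
case: vanish => [q2 | AB0]; rewrite fE.
  have kill c k : weight q k * (c * qnum q k) = 0.
    by rewrite mulrC -mulrA qnum_weight_eq0 // mulr0.
  by case: y => n /=; rewrite ?scalerDr !scalerA !kill !scale0r ?addr0.
have [A0 B0] := AB0 x.
by case: y => n /=; rewrite A0 ?B0 mul0r !scale0r ?addr0 scaler0.
Qed.

End GradedBrackets.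

(** Splitting the coefficients by the family of the left argument gives four
    functions of its degree, the form in which the products are tabulated; the
    case analysis on [q] is then shared by all five. *)
Lemma multiplicative_coefP (K : fieldType) (q : K) (a b c e : int -> K)
    (f : genW -> genW -> Wq K) :
  q != 0 -> q != 1 -> q != -1 ->
  f =2 left_prod q (fun x => match x with inl m => a m | inr m => c m end)
                   (fun x => match x with inl m => b m | inr m => e m end) ->
  hom_multiplicative (WqHom q f) <->
  q ^+ 2 = -1 \/
  [/\ forall m, a m = 0, forall m, b m = 0, forall m, c m = 0
    & forall m, e m = 0].
Proof.
move=> q0 q1 qN1 fE; rewrite (multiplicative_left_prodP q q0 q1 qN1 _ _ _ fE).
split=> -[q2 | z]; [by left | right | by left | right].
  by split=> m; first [exact: (z (inl m)).1 | exact: (z (inl m)).2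
                      | exact: (z (inr m)).1 | exact: (z (inr m)).2].
by case: z => a0 b0 c0 e0 [] m; split.
Qed.

Theorem proposition4p8 (K : fieldType) (charK : [pchar K] =i pred0)
    (q : K) (q_neq0 : q != 0) (q_neqN1 : q != -1) (q_neq1 : q != 1) :
  [/\ (forall nu1 nu2 nu3 nu4 gamma : K,
        hom_multiplicative (WqHom q (prod1 q nu1 nu2 nu3 nu4 gamma)) <->
        q ^+ 2 = -1 \/
        [/\ nu1 = 0, nu2 = 0, nu3 = 0, nu4 = 0 & gamma = 0]),
      (forall nu1 nu2 nu3 nu4 beta gamma : K, beta != 0 ->
        hom_multiplicative (WqHom q (prod2 q nu1 nu2 nu3 nu4 beta gamma)) <->
        q ^+ 2 = -1),
      (forall nu1 nu2 nu3 nu4 beta : K, beta != 0 ->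
        hom_multiplicative (WqHom q (prod3 q nu1 nu2 nu3 nu4 beta)) <->
        q ^+ 2 = -1),
      (forall nu1 nu2 nu3 nu4 beta gamma : K, beta != 0 ->
        hom_multiplicative (WqHom q (prod4 q nu1 nu2 nu3 nu4 beta gamma)) <->
        q ^+ 2 = -1) &
      (forall nu1 nu2 nu3 nu4 beta gamma theta : K, beta != 0 ->
        hom_multiplicative (WqHom q (prod5 q nu1 nu2 nu3 nu4 beta gamma theta)) <->
        q ^+ 2 = -1)].
Proof.
have affine := @delta_affine_eq0 K q q_neq1 q_neqN1.
split.
- move=> nu1 nu2 nu3 nu4 gamma.
  rewrite (@multiplicative_coefP K q (fun m => nu1 * delta q m)
    (fun m => nu3 * delta q m + gamma) (fun m => nu2 * delta q m)
    (fun m => nu4 * delta q m)) //; last by case=> m [] n.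
  split=> -[q2 | z]; [by left | right | by left | right].
    case: z => /delta_scale_eq0 -> /affine[-> ->].
    by move=> /delta_scale_eq0 -> /delta_scale_eq0 ->.
  by case: z => -> -> -> -> ->; split=> m; rewrite mul0r ?addr0.
- move=> nu1 nu2 nu3 nu4 beta gamma /eqP beta_neq0.
  rewrite (@multiplicative_coefP K q (fun m => nu1 * delta q m + beta)
    (fun m => nu3 * delta q m + gamma) (fun m => nu2 * delta q m)
    (fun m => nu4 * delta q m)) //; last by case=> m [] n.
  by split=> [[// | [/affine[_ b0]]] | q2]; [case: beta_neq0 | left].
- move=> nu1 nu2 nu3 nu4 beta /eqP beta_neq0.
  rewrite (@multiplicative_coefP K q (fun m => nu1 * delta q m + beta)
    (fun m => nu3 * delta q m) (fun m => nu2 * delta q m)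
    (fun m => nu4 * delta q m + beta)) //; last by case=> m [] n.
  by split=> [[// | [/affine[_ b0]]] | q2]; [case: beta_neq0 | left].
- move=> nu1 nu2 nu3 nu4 beta gamma /eqP beta_neq0.
  rewrite (@multiplicative_coefP K q (fun m => nu1 * delta q m + gamma)
    (fun m => nu3 * delta q m) (fun m => nu2 * delta q m)
    (fun m => nu4 * delta q m + beta)) //; last by case=> m [] n.
  by split=> [[// | [_ _ _ /affine[_ b0]]] | q2]; [case: beta_neq0 | left].
- move=> nu1 nu2 nu3 nu4 beta gamma theta /eqP beta_neq0.
  rewrite (@multiplicative_coefP K q (fun m => nu1 * delta q m + gamma)
    (fun m => nu3 * delta q m + (gamma * theta - gamma ^+ 2) / beta)
    (fun m => nu2 * delta q m + beta)
    (fun m => nu4 * delta q m + theta - gamma)) //; last by case=> m [] n.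
  by split=> [[// | [_ _ /affine[_ b0]]] | q2]; [case: beta_neq0 | left].
Qed.
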